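(* Let $\mathcal{A}'$ be a line arrangement in $\mathbb{P}^2$ (over $\mathbb{C}$) of type $1$ with exponents $(m_1,m_2,m_3)$ with $m_1\geq 3$. Let $L$ be a line such that the intersection $L\cap\mathcal{A}'$ consists of $\deg\mathcal{A}'=m_1+m_2$ points. Then the line arrangement $\mathcal{A}=\mathcal{A}'\cup L$ has type $2B$ and the exponents of $\mathcal{A}$ are $$(m_1+1,\ m_2+1,\ m_3+1,\ m_1+m_2-1).$$
   Context: A line arrangement is a finite set of distinct lines in $\mathbb{P}^2=\mathbb{P}^2_{\mathbb{C}}$, identified with the reduced curve given by their union; its degree is the number of lines. Let $S=\mathbb{C}[x,y,z]$ with its standard grading. For a reduced curve $C:f=0$ of degree $d$ in $\mathbb{P}^2$, let $$D_0(f)=\{(a,b,c)\in S^3 : af_x+bf_y+cf_z=0\}$$ be the graded $S$-module of Jacobian syzygies, where a homogeneous element $(a,b,c)$ has degree $k$ if $a,b,c$ are homogeneous of degree $k$. Let $d_1\leq d_2\leq\dots\leq d_m$ be the degrees of the elements of a minimal system of homogeneous generators of $D_0(f)$; $(d_1,\dots,d_m)$ are the exponents of $C$. The type of $C$ is $t(C)=d_1+d_2+1-d$. A curve of type $1$ always has $m=3$. A curve of type $2$ has $m=3$ or $m=4$; it is said to be of type $2A$ if $m=3$ and of type $2B$ if $m=4$. *)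

(* Defs.v *)
From HB Require Import structures.
From mathcomp Require Import all_boot all_order all_algebra.
From mathcomp Require Import finmap.
From mathcomp Require Import mpoly.

Set Implicit Arguments.
Unset Strict Implicit.
Unset Printing Implicit Defensive.

Import GRing.Theory.
Local Open Scope ring_scope.

(* A point of P^2 is a one-dimensional subspace of K^3. *)
Definition point (K : fieldType) : Type :=
  {V : {vspace 'rV[K]_3} | \dim V == 1%N}.

(* A line of P^2 is a point of the dual plane: the span of the coefficient
   vector (a, b, c) of a nonzero linear form a x + b y + c z. *)
Definition line (K : fieldType) : Type :=
  {V : {vspace 'cV[K]_3} | \dim V == 1%N}.

(* [vpick] returns a nonzero vector of a nonzero subspace, so [line_form L] is
   an equation of [L]; the choice of the representative only changes it by a
   nonzero scalar. *)
Definition line_form (K : fieldType) (L : line K) : {mpoly K[3]} :=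
  \sum_(i < 3) vpick (val L) i 0 *: 'X_i.

Definition on_line (K : fieldType) (p : point K) (L : line K) : bool :=
  (line_form L).@[fun i => vpick (val p) 0 i] == 0.

Notation arrangement K := {fset line K}.

Definition on_arrangement (K : fieldType) (p : point K) (A : arrangement K)
    : Prop :=
  exists2 H : line K, H \in A & on_line p H.

(* The equation f of the reduced curve formed by the lines of A, which is
   determined up to a nonzero scalar; D_0(f) does not depend on that scalar. *)
Definition arr_eqn (K : fieldType) (A : arrangement K) : {mpoly K[3]} :=
  \prod_(H <- enum_fset A) line_form H.

Definition D0 (K : fieldType) (f : {mpoly K[3]}) (v : 'rV[{mpoly K[3]}]_3)
    : Prop :=
  \sum_(i < 3) v 0 i * f^`M(i) = 0.

Definition homog_of_degree (K : fieldType) (k : nat)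
    (v : 'rV[{mpoly K[3]}]_3) : Prop :=
  forall i, v 0 i \is k.-homog.

Definition generates (K : fieldType) (M : 'rV[{mpoly K[3]}]_3 -> Prop)
    (m : nat) (g : 'I_m -> 'rV[{mpoly K[3]}]_3) (I : {set 'I_m}) : Prop :=
  forall v, M v <->
    exists c : 'I_m -> {mpoly K[3]}, v = \sum_(i in I) c i *: g i.

Definition minimal_generators (K : fieldType)
    (M : 'rV[{mpoly K[3]}]_3 -> Prop)
    (m : nat) (g : 'I_m -> 'rV[{mpoly K[3]}]_3) : Prop :=
  generates M g [set: 'I_m] /\
  (forall I : {set 'I_m}, generates M g I -> I = [set: 'I_m]).

Definition exponents (K : fieldType) (f : {mpoly K[3]}) (ds : seq nat)
    : Prop :=
  sorted leq ds /\
  exists g : 'I_(size ds) -> 'rV[{mpoly K[3]}]_3,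
    minimal_generators (D0 f) g /\
    forall i : 'I_(size ds), homog_of_degree (nth 0%N ds i) (g i).

(* A has exponents ds = (d_1, d_2, ...) and type t = d_1 + d_2 + 1 - deg A. *)
Definition has_type_exponents (K : fieldType) (A : arrangement K)
    (t : int) (ds : seq nat) : Prop :=
  exponents (arr_eqn A) ds /\
  t = (nth 0%N ds 0)%:Z + (nth 0%N ds 1)%:Z + 1 - (#|` A|)%:Z.

Definition type_2B (K : fieldType) (A : arrangement K) : Prop :=
  exists2 ds : seq nat, has_type_exponents A 2 ds & size ds = 4%N.

(* Main.v *)
Require Import Defs.
From mathcomp Require Import all_boot all_order all_algebra.
From mathcomp Require Import finmap mpoly reals complex.
From HB Require Import structures.
From mathcomp Require Import ring zify.

(** Let f be the equation of the arrangement, of degree d = m1 + m2, and l the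
equation of the added line.  A vector of polynomials is read as a derivation:
D_0(f) consists of the derivations that kill f, and E is the Euler derivation.

Adding the line.  A derivation that kills l f maps l into (l), and adding a
multiple of E to it gives one that kills f.  Conversely every eta in D_0(f) has
a lift l eta - eta(l)/(d+1) E to D_0(l f), whose degree is larger by one.  The
cross product T = l x grad f kills both l and f and has degree d - 1; together
with the lifts it generates D_0(l f) (addition_decomposition).  The reason is
that the lines of f meet l = 0 in d distinct points.  A derivation theta that
kills f and preserves l = 0 fixes each of these points, so det(p, E, theta) is
divisible by f modulo l; for such theta one has
d f theta = (E x theta) x grad f, and dividing by f shows that theta is a
multiple of T modulo l (tangent_decomposition).

In a relation between T and the lifts, the coefficient of T is divisible by l,
and the relation descends to one between T and elements of D_0(f)
(addition_relation).  If the degrees of the generators of D_0(f) are less than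
d - 1, then T cannot occur in the component of such a relation in one of these
degrees, so minimality passes from D_0(f) to D_0(l f) (addition_generators).

The degree bound.  What remains is m3 <= d - 2, which also puts the four
degrees in increasing order (third_degree_bound).  Every intersection point q
of two lines of the arrangement carries a derivation in D_0(f) of degree at
most d - 2: the constant field q, multiplied by the lines that miss q and
corrected by a multiple of E (point_field).  If m3 > d - 2, all of them are
combinations of the generators g1 and g2.  Each line of the arrangement divides
det(E, g1, g2), so this determinant is alpha f with alpha a linear form.
For two intersection points q and r on a common line of the arrangement,
det(E, point_field q, point_field r) is, up to a nonzero constant, f times the
product of the lines that miss both q and r (det3_point_fields).  Hence alpha
is proportional to a line of the arrangement that misses q; choosing q on that
line gives a contradiction.

All divisibilities are tested on one line, or one point, at a time: ideals
generated by one or two linear forms are prime (lf_prime), and membership in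
them for every factor of a product gives membership for the product
(ideal2_prod). *)

Set Implicit Arguments.
Unset Strict Implicit.
Unset Printing Implicit Defensive.

Import GRing.Theory Num.Theory.

Local Open Scope ring_scope.

(** * Vector algebra in dimension three *)

Definition i0 : 'I_3 := ord0.
Definition i1 : 'I_3 := @Ordinal 3 1 isT.
Definition i2 : 'I_3 := @Ordinal 3 2 isT.

Lemma ord3_ind (P : 'I_3 -> Prop) : P i0 -> P i1 -> P i2 -> forall i, P i.
Proof.
move=> P0 P1 P2 [[|[|[|i]]] lti] //.
- by rewrite (_ : Ordinal lti = i0) //; apply: val_inj.
- by rewrite (_ : Ordinal lti = i1) //; apply: val_inj.
- by rewrite (_ : Ordinal lti = i2) //; apply: val_inj.
Qed.

HB.lock Definition dot (A : comNzRingType) (u v : 'rV[A]_3) : A :=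
  \sum_(i < 3) u 0 i * v 0 i.

HB.lock Definition cross (A : comNzRingType) (u v : 'rV[A]_3) : 'rV[A]_3 :=
  \row_i nth 0 [:: u 0 i1 * v 0 i2 - u 0 i2 * v 0 i1;
                   u 0 i2 * v 0 i0 - u 0 i0 * v 0 i2;
                   u 0 i0 * v 0 i1 - u 0 i1 * v 0 i0] i.

Section Vectors.
Variable A : comNzRingType.
Implicit Types (u v w a b c : 'rV[A]_3) (s t : A).

Lemma row3P u v :
  u 0 i0 = v 0 i0 -> u 0 i1 = v 0 i1 -> u 0 i2 = v 0 i2 -> u = v.
Proof. by move=> *; apply/rowP; apply: ord3_ind. Qed.

Definition det3 u v w : A := dot u (cross v w).

Lemma dotE u v :
  dot u v = u 0 i0 * v 0 i0 + u 0 i1 * v 0 i1 + u 0 i2 * v 0 i2.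
Proof.
rewrite dot.unlock !big_ord_recr big_ord0 /= add0r.
by congr (u 0 _ * v 0 _ + u 0 _ * v 0 _ + u 0 _ * v 0 _); apply: val_inj.
Qed.

Lemma crossE0 u v : cross u v 0 i0 = u 0 i1 * v 0 i2 - u 0 i2 * v 0 i1.
Proof. by rewrite cross.unlock mxE. Qed.
Lemma crossE1 u v : cross u v 0 i1 = u 0 i2 * v 0 i0 - u 0 i0 * v 0 i2.
Proof. by rewrite cross.unlock mxE. Qed.
Lemma crossE2 u v : cross u v 0 i2 = u 0 i0 * v 0 i1 - u 0 i1 * v 0 i0.
Proof. by rewrite cross.unlock mxE. Qed.
Definition vecE := (dotE, crossE0, crossE1, crossE2).

Lemma dotC u v : dot u v = dot v u.
Proof. by rewrite !dotE; ring. Qed.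

Lemma dotDl u v w : dot (u + v) w = dot u w + dot v w.
Proof. by rewrite !dotE !mxE; ring. Qed.

Lemma dotZl s u w : dot (s *: u) w = s * dot u w.
Proof. by rewrite !dotE !mxE; ring. Qed.

Lemma dotNl u w : dot (- u) w = - dot u w.
Proof. by rewrite !dotE !mxE; ring. Qed.

Lemma dotDr u v w : dot w (u + v) = dot w u + dot w v.
Proof. by rewrite dotC dotDl !(dotC w). Qed.

Lemma dotZr s u w : dot w (s *: u) = s * dot w u.
Proof. by rewrite dotC dotZl !(dotC w). Qed.

Lemma dotNr u w : dot w (- u) = - dot w u.
Proof. by rewrite dotC dotNl !(dotC w). Qed.

Lemma dot0l w : dot 0 w = 0.
Proof. by rewrite !dotE !mxE; ring. Qed.

Lemma dot0r w : dot w 0 = 0.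
Proof. by rewrite dotC dot0l. Qed.

Lemma dot_suml (I : finType) (P : pred I) (F : I -> 'rV[A]_3) w :
  dot (\sum_(i | P i) F i) w = \sum_(i | P i) dot (F i) w.
Proof.
by apply: (big_morph (fun u => dot u w)) => [u v|]; rewrite (dotDl, dot0l).
Qed.

Lemma dot_crossl u v : dot u (cross u v) = 0.
Proof. by rewrite !vecE; ring. Qed.

Lemma dot_crossr u v : dot v (cross u v) = 0.
Proof. by rewrite !vecE; ring. Qed.

Lemma det3_rot u v w : det3 u v w = det3 v w u.
Proof. by rewrite /det3 !vecE; ring. Qed.

Lemma crossC u v : cross u v = - cross v u.
Proof. by apply: row3P; rewrite !(vecE, mxE); ring. Qed.

Lemma crossZr s u v : cross u (s *: v) = s *: cross u v.
Proof. by apply: row3P; rewrite !(vecE, mxE); ring. Qed.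

Lemma crossDr u v w : cross w (u + v) = cross w u + cross w v.
Proof. by apply: row3P; rewrite !(vecE, mxE); ring. Qed.

Lemma cross0r u : cross u 0 = 0.
Proof. by apply: row3P; rewrite !(vecE, mxE); ring. Qed.

Lemma crossxx u : cross u u = 0.
Proof. by apply: row3P; rewrite !(vecE, mxE); ring. Qed.

(** Distinct parameters give distinct points of the line spanned by u and v. *)
Lemma cross_secant s t u v :
  cross (u + s *: v) (u + t *: v) = (t - s) *: cross u v.
Proof. by apply: row3P; rewrite !(vecE, mxE); ring. Qed.

Lemma cross_cross u v w : cross u (cross v w) = dot u w *: v - dot u v *: w.
Proof. by apply: row3P; rewrite !(vecE, mxE); ring. Qed.

Lemma det3_cramer u v w a :
  det3 u v w *: a =
  dot u a *: cross v w + dot v a *: cross w u + dot w a *: cross u v.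
Proof. by apply: row3P; rewrite /det3 !(vecE, mxE); ring. Qed.

Lemma det3_cramer_dot u v w a b : det3 u v w * dot a b =
  dot u b * det3 a v w + dot v b * det3 a w u + dot w b * det3 a u v.
Proof. by rewrite /det3 !vecE; ring. Qed.

(** The matrix of scalar products is the product of one matrix with the transpose
of the other, and determinants are multiplicative. *)
Lemma det3_gram u v w a b c : det3 u v w * det3 a b c =
  dot u a * (dot v b * dot w c - dot v c * dot w b)
  - dot u b * (dot v a * dot w c - dot v c * dot w a)
  + dot u c * (dot v a * dot w b - dot v b * dot w a).
Proof. by rewrite /det3 !vecE; ring. Qed.

Lemma row_multiple s u :
  (forall i, exists q, u 0 i = q * s) -> exists v, u = s *: v.
Proof.
move=> /fin_all_exists [q uE]; exists (\row_i q i).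
by apply/rowP => i; rewrite !mxE uE mulrC.
Qed.

Lemma det3_lin2 u v w x y x' y' :
  det3 u (x *: v + y *: w) (x' *: v + y' *: w) = (x * y' - y * x') * det3 u v w.
Proof. by rewrite /det3 !(vecE, mxE); ring. Qed.

Lemma det3_shear u v w x y x' y' :
  det3 u (x *: v - y *: u) (x' *: w - y' *: u) = x * x' * det3 u v w.
Proof. by rewrite /det3 !(vecE, mxE); ring. Qed.

(** In the plane: the points where the line u meets v and w span u again, unless
the three lines are concurrent. *)
Lemma cross_pencil u v w : cross (cross u v) (cross u w) = det3 u v w *: u.
Proof. by apply: row3P; rewrite /det3 !(vecE, mxE); ring. Qed.

End Vectors.

Section FieldVectors.
Variable K : fieldType.
Implicit Types a b c : 'rV[K]_3.

Lemma neq0_dot a : a != 0 -> exists e, dot e a = 1.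
Proof.
move=> a0; have [i ai] : exists i, a 0 i != 0.
  apply/existsP; apply: contra_neqT a0 => /existsPn a0.
  by apply/rowP => i; rewrite mxE; apply/eqP; have := a0 i; rewrite negbK.
exists ((a 0 i)^-1 *: delta_mx 0 i); rewrite dotZl dot.unlock (bigD1 i) //=.
rewrite big1 => [|j ji]; last by rewrite mxE eqxx (negbTE ji) mul0r.
by rewrite mxE !eqxx mul1r addr0 mulVf.
Qed.

(** Expanding e x (a x b) with e.a = 1 expresses b as a multiple of a. *)
Lemma parallel a b : a != 0 -> cross a b = 0 -> exists t, b = t *: a.
Proof.
move=> /neq0_dot [e ea] ab; exists (dot e b).
have := cross_cross e a b; rewrite ab ea scale1r cross0r.
by move=> /esym/eqP; rewrite subr_eq0 => /eqP ->.
Qed.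

Lemma cross_eq0_trans a b c : a != 0 -> cross a b = 0 -> cross a c = 0 ->
  cross b c = 0.
Proof.
move=> a0 /(parallel a0) [t ->] /(parallel a0) [t' ->].
by rewrite crossZr crossC crossZr crossxx scaler0 oppr0 scaler0.
Qed.

End FieldVectors.

(** * Ideals with two generators *)

Section Ideal.
Variable A : comNzRingType.
Implicit Types (x y z : A).

(** A zero generator is allowed, so that principal ideals and their sums with a
fixed ideal are treated together. *)
Definition ideal2 x y z := exists p q, z = p * x + q * y.

Lemma ideal2D x y z z' : ideal2 x y z -> ideal2 x y z' -> ideal2 x y (z + z').
Proof. by move=> [p [q ->]] [p' [q' ->]]; exists (p + p'), (q + q'); ring. Qed.

Lemma ideal2Ml x y t z : ideal2 x y z -> ideal2 x y (t * z).
Proof. by move=> [p [q ->]]; exists (t * p), (t * q); ring. Qed.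

Lemma ideal2Mr x y t z : ideal2 x y z -> ideal2 x y (z * t).
Proof. by rewrite mulrC; apply: ideal2Ml. Qed.

Lemma ideal2N x y z : ideal2 x y z -> ideal2 x y (- z).
Proof. by rewrite -mulN1r; apply: ideal2Ml. Qed.

Lemma ideal2_0 x y : ideal2 x y 0.
Proof. by exists 0, 0; ring. Qed.

Lemma ideal2_l x y : ideal2 x y x.
Proof. by exists 1, 0; ring. Qed.

Lemma ideal2_r x y : ideal2 x y y.
Proof. by exists 0, 1; ring. Qed.

Lemma ideal2_x0 x z : ideal2 x 0 z -> exists q, z = q * x.
Proof. by move=> [p [q ->]]; exists p; ring. Qed.

Lemma ideal2_0x x z : ideal2 0 x z -> exists q, z = q * x.
Proof. by move=> [p [q ->]]; exists q; ring. Qed.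

Lemma ideal2C x y z : ideal2 x y z -> ideal2 y x z.
Proof. by move=> [p [q ->]]; exists q, p; ring. Qed.

(** The unit ideal satisfies it too. *)
Definition prime_ideal2 x y :=
  forall z t, ideal2 x y (z * t) -> ideal2 x y z \/ ideal2 x y t.

Lemma prod_in_ideal2 (T : eqType) (F : T -> A) (s : seq T) x y :
  prime_ideal2 x y -> ~ ideal2 x y 1 ->
  ideal2 x y (\prod_(k <- s) F k) -> exists2 k, k \in s & ideal2 x y (F k).
Proof.
move=> pr n1; elim: s => [|k s IHs]; first by rewrite big_nil.
rewrite big_cons => /pr [Fk|/IHs [k' k's Fk']].
  by exists k; rewrite ?mem_head.
by exists k'; rewrite // inE k's orbT.
Qed.

(** Since F k is not a zero divisor modulo (x, F j), a multiple of F k that lies in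
(x, F j) has its cofactor there, which lets the factors be split off one by
one. *)
Lemma ideal2_prod (T : eqType) (F : T -> A) (s : seq T) x z :
  uniq s ->
  {in s, forall k, prime_ideal2 x (F k)} ->
  {in s &, forall k k', k != k' -> ~ ideal2 x (F k') (F k)} ->
  {in s, forall k, ideal2 x (F k) z} ->
  ideal2 x (\prod_(k <- s) F k) z.
Proof.
elim: s z => [|k s IHs] z /=.
  by move=> *; rewrite big_nil; exists 0, z; ring.
move=> /andP[ks us] pr cop zs; rewrite big_cons.
have [p [q zE]] : ideal2 x (F k) z by apply: zs; rewrite mem_head.
have : ideal2 x (\prod_(j <- s) F j) q.
  apply: IHs => // [j js|j j' js j's|j js].
  - by apply: pr; rewrite inE js orbT.
  - by apply: cop; rewrite inE ?js ?j's orbT.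
  have jks : j \in k :: s by rewrite inE js orbT.
  have qk : ideal2 x (F j) (F k * q).
    have -> : F k * q = z + (- p) * x by rewrite zE; ring.
    by apply: ideal2D; [exact: zs | apply/ideal2Ml/ideal2_l].
  case: (pr j jks _ _ qk) => // kj; case: (cop k j _ jks _ kj) => //.
    by rewrite mem_head.
  by apply: contraNneq ks => ->.
by move=> [p' [q' qE]]; exists (p + p' * F k), q'; rewrite zE qE; ring.
Qed.

End Ideal.

(** * Linear forms, gradients and the primes that linear forms generate *)

HB.lock Definition cst (K : fieldType) (a : 'rV[K]_3) : 'rV[{mpoly K[3]}]_3 :=
  map_mx (@mpolyC 3 K) a.
HB.lock Definition euler (K : fieldType) : 'rV[{mpoly K[3]}]_3 := \row_i 'X_i.
HB.lock Definition grad (K : fieldType) (F : {mpoly K[3]}) :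
  'rV[{mpoly K[3]}]_3 := \row_i F^`M(i).
HB.lock Definition lf (K : fieldType) (a : 'rV[K]_3) : {mpoly K[3]} :=
  dot (euler K) (cst a).

Section Forms.
Variable K : fieldType.
Local Notation S := {mpoly K[3]}.
Implicit Types (a b c p : 'rV[K]_3) (F G : S) (u v w : 'rV[S]_3).

Definition at_pt F p : K := F.@[fun i => p 0 i].

Lemma cstE a i : cst a 0 i = (a 0 i)%:MP.
Proof. by rewrite cst.unlock mxE. Qed.

Lemma eulerE i : euler K 0 i = 'X_i.
Proof. by rewrite euler.unlock mxE. Qed.

Lemma gradE F i : grad F 0 i = F^`M(i).
Proof. by rewrite grad.unlock mxE. Qed.

Lemma lfE a : lf a = dot (euler K) (cst a).
Proof. by rewrite lf.unlock. Qed.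

Definition cE := (mxE, cstE, eulerE, gradE).

Lemma dot_cst a b : dot (cst a) (cst b) = (dot a b)%:MP.
Proof. by rewrite !dotE !cE !mpolyCD !mpolyCM. Qed.

Lemma cross_cst a b : cross (cst a) (cst b) = cst (cross a b).
Proof. by apply: row3P; rewrite !(cE, vecE) !mpolyCB !mpolyCM. Qed.

Lemma det3_cst a b c : det3 (cst a) (cst b) (cst c) = (det3 a b c)%:MP.
Proof. by rewrite /det3 cross_cst dot_cst. Qed.

Lemma lf0 : lf (0 : 'rV[K]_3) = 0.
Proof. by rewrite !lfE dotE !cE !mpolyC0; ring. Qed.

Lemma lfZ t a : lf (t *: a) = t%:MP * lf a.
Proof. by rewrite !lfE !dotE !cE !mpolyCM; ring. Qed.

Lemma at_lf a p : at_pt (lf a) p = dot a p.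
Proof.
by rewrite /at_pt lfE !dotE !cE !mevalD !mevalM !mevalXU !mevalC; ring.
Qed.

Lemma at_ideal2 F G H p : at_pt F p = 0 -> at_pt G p = 0 ->
  ideal2 F G H -> at_pt H p = 0.
Proof.
rewrite /at_pt => F0 G0 [q [q' ->]].
by rewrite mevalD !mevalM F0 G0 !mulr0 addr0.
Qed.

Lemma cst_eq0 a : cst a = 0 -> a = 0.
Proof.
move=> /rowP a0; apply/rowP => i; rewrite mxE; apply/eqP.
by rewrite -(mpolyC_eq0 3) -cstE a0 mxE.
Qed.

Lemma lf_neq0 a : a != 0 -> lf a != 0.
Proof.
move=> /neq0_dot [e ea]; apply/eqP => lf0; have := at_lf a e.
by rewrite lf0 /at_pt meval0 dotC ea => /esym/eqP; rewrite oner_eq0.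
Qed.

(** Composition with the linear map that subtracts its components along p and p';
for p, p' dual to a, b it is the projection onto the common zeros of a and b. *)
Definition proj_sub a p b p' : 3.-tuple S :=
  [tuple 'X_i - (p 0 i)%:MP * lf a - (p' 0 i)%:MP * lf b | i < 3].

Lemma comp_mpolyM (pi : 3.-tuple S) F G :
  (F * G) \mPo pi = (F \mPo pi) * (G \mPo pi).
Proof. exact: rmorphM. Qed.

(** The polynomials that a substitution changes only modulo the ideal form a
subring, which contains the variables by hypothesis. *)
Lemma comp_mpoly_congr F G (pi : 3.-tuple S) H :
  (forall i, ideal2 F G ('X_i - tnth pi i)) -> ideal2 F G (H - (H \mPo pi)).
Proof.
move=> XI.
have sM x y : ideal2 F G (x - (x \mPo pi)) -> ideal2 F G (y - (y \mPo pi)) ->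
    ideal2 F G (x * y - (x * y \mPo pi)).
  move=> Ix Iy; rewrite comp_mpolyM.
  have -> : x * y - (x \mPo pi) * (y \mPo pi) =
    (x - (x \mPo pi)) * y + (x \mPo pi) * (y - (y \mPo pi)) by ring.
  by apply: ideal2D; [apply: ideal2Mr | apply: ideal2Ml].
have s1 : ideal2 F G (1 - (1 \mPo pi)).
  by rewrite comp_mpoly1 subrr; apply: ideal2_0.
have sX m : ideal2 F G ('X_[m] - ('X_[m] \mPo pi)).
  rewrite mpolyXE_id; elim/big_ind: _; [exact: s1 | exact: sM | move=> i _].
  elim: (m i) => [|k IHk]; first by rewrite expr0; exact: s1.
  rewrite exprS; apply: sM; last exact: IHk.
  by rewrite comp_mpolyXU -tnth_nth; exact: XI.
elim/mpolyind: H => [|t m p _ _ Ip].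
  by rewrite comp_mpoly0 subrr; apply: ideal2_0.
rewrite comp_mpolyD comp_mpolyZ opprD addrACA -scalerBr -mul_mpolyC.
by apply: ideal2D; [apply: ideal2Ml; exact: sX | exact: Ip].
Qed.

Lemma comp_proj a p b p' c :
  lf c \mPo proj_sub a p b p' =
  lf c - (dot p c)%:MP * lf a - (dot p' c)%:MP * lf b.
Proof.
rewrite {1}lfE dotE !(comp_mpolyD, comp_mpolyM) !cE !comp_mpolyC.
rewrite !comp_mpolyXU -!tnth_nth !tnth_mktuple.
rewrite [lf c]lfE !dotE !cE !mpolyCD !mpolyCM.
by move: (lf a) (lf b) => x y; ring.
Qed.

(** Such a substitution is a retraction with the ideal as kernel, so the quotient
embeds in the polynomial ring; this is where primality comes from. *)
Lemma ideal2_subst F G (pi : 3.-tuple S) H :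
  (forall i, ideal2 F G ('X_i - tnth pi i)) ->
  F \mPo pi = 0 -> G \mPo pi = 0 -> ideal2 F G H <-> H \mPo pi = 0.
Proof.
move=> XI F0 G0; split=> [[q [q' ->]]|H0].
  by rewrite comp_mpolyD !comp_mpolyM F0 G0 !mulr0 addr0.
by rewrite -[H]subr0 -H0; apply: comp_mpoly_congr.
Qed.

Lemma proj_sub_congr a p b p' i :
  ideal2 (lf a) (lf b) ('X_i - tnth (proj_sub a p b p') i).
Proof.
rewrite tnth_mktuple; exists (p 0 i)%:MP, (p' 0 i)%:MP.
by move: (lf a) (lf b) 'X_i => x y z; ring.
Qed.

(** The projection onto the common zeros of the two forms identifies the quotient
with a subring of a domain.  The second form is zero or independent of the
first. *)
Lemma lf_prime a b : a != 0 -> b = 0 \/ cross a b != 0 ->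
  prime_ideal2 (lf a) (lf b).
Proof.
move=> a0 ab.
(* (p, p') is the dual basis of (a, b), by Cramer's rule with a third vector e. *)
have [p [p' [Ea Eb]]] : exists p p', lf a \mPo proj_sub a p b p' = 0 /\
     lf b \mPo proj_sub a p b p' = 0.
  case: ab => [->|].
    have [p pa] := neq0_dot a0.
    exists p, 0; rewrite lf0 comp_mpoly0 comp_proj pa lf0 mpolyC1 mul1r mulr0.
    by rewrite subrr subr0.
  move=> /neq0_dot [e eab].
  exists (cross b e), (cross e a); rewrite !comp_proj.
  have -> : dot (cross b e) a = 1 by rewrite -eab !vecE; ring.
  have -> : dot (cross b e) b = 0 by rewrite !vecE; ring.
  have -> : dot (cross e a) a = 0 by rewrite !vecE; ring.
  have -> : dot (cross e a) b = 1 by rewrite -eab !vecE; ring.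
  rewrite mpolyC0 mpolyC1; move: (lf a) (lf b) => x y.
  by split; ring.
have memE H := ideal2_subst H (proj_sub_congr a p b p') Ea Eb.
move=> F G; rewrite !memE comp_mpolyM => /eqP.
by rewrite mulf_eq0 => /orP[] /eqP ->; [left | right].
Qed.

Lemma lf_prime1 a : a != 0 -> prime_ideal2 (lf a) 0.
Proof. by move=> a0; rewrite -lf0; apply: lf_prime; [|left]. Qed.

(** Some point lies on the line a but not on the line c. *)
Lemma lf_notin1 a c : cross a c != 0 -> ~ ideal2 (lf a) 0 (lf c).
Proof.
move=> /neq0_dot [e eac] /(@at_ideal2 _ _ _ (cross e a)).
rewrite !at_lf /at_pt meval0 => H; move/eqP: (oner_neq0 K); apply.
rewrite -H //; last by rewrite !vecE; ring.
by rewrite -eac !vecE; ring.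
Qed.

(** The intersection point a x b of the lines a and b does not lie on c. *)
Lemma lf_notin2 a b c : det3 a b c != 0 -> ~ ideal2 (lf a) (lf b) (lf c).
Proof.
move=> /eqP abc /(@at_ideal2 _ _ _ (cross a b)).
rewrite !at_lf dot_crossl dot_crossr => /(_ erefl erefl) H; apply: abc.
by rewrite -H /det3 !vecE; ring.
Qed.

Lemma one_notin1 a : ~ ideal2 (lf a) 0 1.
Proof.
move=> /(@at_ideal2 _ _ _ 0); rewrite !at_lf /at_pt meval0 meval1 => H.
move/eqP: (oner_neq0 K); apply; apply: H => //.
by rewrite dotE !mxE; ring.
Qed.

End Forms.

(** * Logarithmic derivations of an arrangement *)

Section Log.
Variable K : fieldType.
Local Notation S := {mpoly K[3]}.
Implicit Types (a b c l p : 'rV[K]_3) (F G : S) (u v w th : 'rV[S]_3).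
Implicit Types (s : seq 'rV[K]_3).

Lemma gradM F G : grad (F * G) = F *: grad G + G *: grad F.
Proof. by apply/rowP => i; rewrite !cE mderivM; ring. Qed.

Lemma grad1 : grad (1 : S) = 0.
Proof. by apply/rowP => i; rewrite !cE mderivC. Qed.

Lemma grad_lf a : grad (lf a) = cst a.
Proof.
apply/rowP => i; rewrite !cE lfE dot.unlock raddf_sum (bigD1 i) //=.
rewrite big1 => [|j ji]; rewrite !cE mderivM mderivC mulr0 addr0 mderivX mnm1E.
  by rewrite eqxx scale1r -{1}[U_(i)%MM]add0m addmK mpolyX0 mul1r ?addr0.
by rewrite (negbTE ji) scale0r mul0r.
Qed.

Definition arr s : S := \prod_(a <- s) lf a.

(** The cases of interest are F = 0, a field along which every form is constant,
and F = 1, the Euler field. *)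
Lemma der_arr (P : pred 'rV[K]_3) th s F :
  {in s, forall a, P a -> dot th (cst a) = F * lf a} ->
  dot th (grad (\prod_(a <- s | P a) lf a)) =
  (count P s)%:R * F * \prod_(a <- s | P a) lf a.
Proof.
elim: s => [|a s IHs] thE; first by rewrite !big_nil grad1 dot0r !mul0r.
rewrite !big_cons /=.
have IH : {in s, forall b, P b -> dot th (cst b) = F * lf b}.
  by move=> b bs; apply: thE; rewrite inE bs orbT.
have /= := thE a (mem_head _ _).
case: (P a) => /= [/(_ isT) tha|_]; last exact: IHs.
rewrite gradM dotDr !dotZr grad_lf tha IHs // natrD.
by move: (lf a) (\prod_(_ <- _ | _) _) => x y; ring.
Qed.

(** Equations of pairwise distinct lines. *)
Definition independent_forms s :=
  [/\ uniq s, {in s, forall a, a != 0} &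
      {in s &, forall a b, a != b -> cross a b != 0}].

(** The line l is not in the arrangement and passes through none of its
intersection points. *)
Definition transverse l s :=
  [/\ l != 0, {in s, forall a, cross l a != 0} &
      {in s &, forall a b, a != b -> det3 l a b != 0}].

(** Derivations tangent to every line of the arrangement. *)
Definition logarithmic s th :=
  {in s, forall a, ideal2 (lf a) 0 (dot th (cst a))}.

Lemma lf_arr_notin l (P : pred 'rV[K]_3) s : l != 0 ->
  {in s, forall a, P a -> cross l a != 0} ->
  ~ ideal2 (lf l) 0 (\prod_(a <- s | P a) lf a).
Proof.
move=> l0 ls; rewrite -big_filter => H.
have [a] := prod_in_ideal2 (lf_prime1 l0) (@one_notin1 K l) H.
by rewrite mem_filter => /andP[Pa als]; apply: lf_notin1; exact: ls.
Qed.

(** Write the equation as a G.  Then a divides theta(a) G, and no other line of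
the arrangement is proportional to a. *)
Lemma der_logarithmic s th : independent_forms s ->
  ideal2 (arr s) 0 (dot th (grad (arr s))) -> logarithmic s th.
Proof.
move=> [us s0 cs] sth a als.
have [q] := ideal2_x0 sth; rewrite /arr (big_rem a als) /= gradM dotDr !dotZr.
rewrite grad_lf; set G := \prod_(_ <- _ | _) _ => E.
case: (lf_prime1 (s0 a als) (z := G) (t := dot th (cst a))) => [|GI|] //.
  exists (q * G - dot th (grad G)), 0.
  move/(canRL (addKr _)): E => ->; by move: (lf a) => x; ring.
exfalso; move: GI; apply: lf_arr_notin; first exact: s0.
move=> b bs _; apply: cs => //; first exact: (mem_rem bs).
by apply: contraTneq bs => <-; rewrite mem_rem_uniq // inE eqxx.
Qed.

Lemma euler_logarithmic s : logarithmic s (euler K).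
Proof. by move=> a _; rewrite -lfE; exact: ideal2_l. Qed.

(** One half of Saito's criterion: along the line a the three vectors lie in the
plane a = 0, so a divides their determinant. *)
Lemma det3_logarithmic s u v w : independent_forms s ->
  logarithmic s u -> logarithmic s v -> logarithmic s w ->
  exists q, det3 u v w = q * arr s.
Proof.
move=> [us s0 cs] lu lv lw; apply: ideal2_0x; apply: ideal2_prod => //.
- move=> a als x y /ideal2C.
  by move=> /(lf_prime1 (s0 a als))[] /ideal2C; [left|right].
- move=> a b als bls ab /ideal2C; apply: lf_notin1.
  by apply: cs => //; rewrite eq_sym.
move=> a als; apply: ideal2C; have [e ea] := neq0_dot (s0 a als).
have : ideal2 (lf a) 0 (det3 u v w * dot (cst e) (cst a)).
  rewrite det3_cramer_dot.
  by apply: ideal2D; [apply: ideal2D|]; apply: ideal2Mr;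
    [apply: lu | apply: lv | apply: lw].
by rewrite dot_cst ea mpolyC1 mulr1.
Qed.

(** At the point where l meets a line a of the arrangement, u and v both have
the direction of that point, hence are proportional. *)
Lemma det3_transverse l s u v p : independent_forms s -> transverse l s ->
  logarithmic s u -> logarithmic s v ->
  ideal2 (lf l) 0 (dot u (cst l)) -> ideal2 (lf l) 0 (dot v (cst l)) ->
  ideal2 (lf l) (arr s) (det3 u v (cst p)).
Proof.
move=> [us s0 cs] [l0 lc ld] lu lv ul vl; apply: ideal2_prod => //.
- by move=> a als; apply: lf_prime => //; right; apply: lc.
- move=> a b als bls ab; apply: lf_notin2.
  by apply: ld => //; rewrite eq_sym.
move=> a als; have [e ea] := neq0_dot (lc a als).
have ext x : ideal2 (lf l) 0 x -> ideal2 (lf l) (lf a) x.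
  by move=> /ideal2_x0 [q ->]; apply/ideal2Ml/ideal2_l.
have ext' x : ideal2 (lf a) 0 x -> ideal2 (lf l) (lf a) x.
  by move=> /ideal2_x0 [q ->]; apply/ideal2Ml/ideal2_r.
have : ideal2 (lf l) (lf a) (det3 u v (cst p) * det3 (cst l) (cst a) (cst e)).
  have := (ext _ ul, ext _ vl, ext' _ (lu a als), ext' _ (lv a als)).
  rewrite det3_gram.
  move: (dot u _) (dot v (cst l)) (dot u (cst a)) (dot v (cst a)).
  move=> x1 x2 x3 x4 [[[I1 I2] I3] I4].
  apply: ideal2D; [apply: ideal2D; [|apply: ideal2N] | ]; try exact: ideal2Mr.
  by apply: ideal2Ml; apply: ideal2D; [|apply: ideal2N]; exact: ideal2Mr.
by rewrite det3_cst -(det3_rot e) [det3 e l a]/det3 ea mpolyC1 mulr1.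
Qed.

(** The derivation g |-> det(l, grad F, grad g), the Jacobian derivation of
the pair l, F. *)
Definition tangent_field l F : 'rV[S]_3 := cross (cst l) (grad F).

Lemma tangent_field_l l F : dot (tangent_field l F) (cst l) = 0.
Proof. by rewrite dotC dot_crossl. Qed.

Lemma tangent_field_D0 l F : dot (tangent_field l F) (grad F) = 0.
Proof. by rewrite dotC dot_crossr. Qed.

Lemma euler_arr s : dot (euler K) (grad (arr s)) = (size s)%:R * arr s.
Proof.
rewrite /arr (@der_arr _ _ _ 1) => [|a _ _]; last by rewrite mul1r lfE.
by rewrite count_predT mulr1.
Qed.

(** Modulo l the vector E x theta is orthogonal to E and theta, which both kill l,
so it is a multiple of the coefficient vector of l, and by det3_transverse that
multiple is divisible by the equation of the arrangement.  Taking the cross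
product with the gradient recovers theta. *)
Lemma tangent_decomposition l s th : independent_forms s -> transverse l s ->
  (size s)%:R != 0 :> K ->
  dot th (grad (arr s)) = 0 -> ideal2 (lf l) 0 (dot th (cst l)) ->
  exists q eta, th = q *: tangent_field l (arr s) + lf l *: eta.
Proof.
move=> ls tls d0 th0 thl; have [l0 lc ld] := tls.
have [p pl] := neq0_dot l0.
have logth : logarithmic s th.
  by apply: der_logarithmic => //; rewrite th0; apply: ideal2_0.
have eul : ideal2 (lf l) 0 (dot (euler K) (cst l)).
  by rewrite -lfE; apply: ideal2_l.
have [x [q DE]] := det3_transverse p ls tls (@euler_logarithmic s) logth eul thl.
have [h hE] := ideal2_x0 thl.
set f := arr s in th0 DE *; set w := cross (euler K) th.
(* Cramer's rule for the coefficient vector of l in the frame E, theta, p, where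
   E and theta have a value divisible by l and p has the value 1. *)
have [eta1 wE] : exists eta, w = q * f *: cst l + lf l *: eta.
  have := det3_cramer (euler K) th (cst p) (cst l).
  rewrite dot_cst pl mpolyC1 scale1r -lfE hE DE -/w.
  move: (cross th _) (cross _ (euler K)) => u v /esym/(canRL (addKr _)) ->.
  exists (x *: cst l - u - h *: v); apply/rowP => i; rewrite !mxE; ring.
(* grad f x (E x theta) = - d f theta, by the triple product formula, because
   theta kills f. *)
have key : ((size s)%:R * f) *: th =
   (q * f) *: tangent_field l f + lf l *: cross eta1 (grad f).
  have := cross_cross (grad f) (euler K) th.
  rewrite (dotC _ th) th0 scale0r sub0r (dotC _ (euler K)) euler_arr -/w wE.
  rewrite crossDr !crossZr ![cross (grad f) _]crossC !scalerN -opprD.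
  by move=> /oppr_inj <-.
have cong i :
    exists y, (size s)%:R * th 0 i - q * tangent_field l f 0 i = y * lf l.
  have := congr1 (fun u => u 0 i) key; rewrite !mxE => keyi.
  apply: ideal2_x0; case: (lf_prime1 l0 (z := f)
    (t := (size s)%:R * th 0 i - q * tangent_field l f 0 i)) => //.
    exists (cross eta1 (grad f) 0 i), 0.
    move: keyi; move: (th 0 i) (tangent_field l f 0 i) => t c keyi.
    by rewrite mulr0 addr0 -[LHS](_ : (size s)%:R * f * t - q * f * c = _);
      [rewrite keyi; ring | ring].
  move=> fl; exfalso; apply: (lf_arr_notin (P := xpredT) l0 _ fl) => a als _.
  exact: lc.
have [v vE] :
    exists v, (size s)%:R *: th - q *: tangent_field l f = lf l *: v.
  by apply: row_multiple => i; have [y yE] := cong i; exists y; rewrite !mxE.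
pose r : S := ((size s)%:R^-1)%:MP.
have rd : r * (size s)%:R = 1.
  by rewrite /r -mpolyC_nat -mpolyCM mulVf // mpolyC1.
exists (r * q), (r *: v).
rewrite scalerA [lf l * r]mulrC -!scalerA -vE scalerBr.
by rewrite [r *: (_ *: th)]scalerA rd scale1r addrC subrK.
Qed.

End Log.

(** * Homogeneous components *)

Section Homog.
Variable K : fieldType.
Local Notation S := {mpoly K[3]}.
Implicit Types (a b c l p q : 'rV[K]_3) (F G : S) (u v w th : 'rV[S]_3).
Implicit Types (s : seq 'rV[K]_3).
Local Notation part k F := (pihomog (@mdeg 3) k F).

Lemma pihomogM_homog e k F G : G \is e.-homog ->
  part k (F * G) = if (e <= k)%N then part (k - e) F * G else 0.
Proof.
move=> Gh; pose N := (msize F + k.+1)%N.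
have FN : F = \sum_(d < N) part d F.
  by apply: pihomog_partitionE; rewrite leq_addr.
rewrite {1}FN mulr_suml linear_sum /=.
have Fh d : part d F * G \is (d + e).-homog.
  by apply: dhomogM => //; apply: pihomogP.
case: leqP => ek; last first.
  apply: big1 => d _; apply: (pihomog_ne0 _ (Fh d)).
  by rewrite neq_ltn (leq_trans ek) ?leq_addl ?orbT.
have kN : (k - e < N)%N by rewrite /N; lia.
rewrite (bigD1 (Ordinal kN)) //= big1 ?addr0 => [|d dk].
  by apply: pihomog_dE; rewrite -{2}(subnK ek).
apply: (pihomog_ne0 _ (Fh d)); apply: contra dk => /eqP dk.
by apply/eqP/val_inj; rewrite /= -dk addnK.
Qed.

(** In a combination that is homogeneous, the coefficients can be taken
homogeneous of complementary degrees; generators of too large a degree drop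
out. *)
Lemma homog_combination (I : finType) k v (w : I -> 'rV[S]_3) (e : I -> nat)
    (c : I -> S) :
  homog_of_degree k v -> (forall j, homog_of_degree (e j) (w j)) ->
  v = \sum_j c j *: w j ->
  v = \sum_j (if (e j <= k)%N then part (k - e j) (c j) else 0) *: w j.
Proof.
move=> vh wh vE; apply/rowP => i; rewrite summxE -(pihomog_dE (vh i)).
rewrite {1}vE summxE linear_sum /=; apply: eq_bigr => j _.
rewrite !mxE (pihomogM_homog _ _ (wh j i)).
by case: ifP; rewrite ?mul0r.
Qed.

Lemma lf_homog a : lf a \is 1.-homog.
Proof.
rewrite lfE dot.unlock; apply: rpred_sum => i _.
rewrite cstE eulerE mulrC mul_mpolyC; apply: dhomogZ.
by rewrite dhomogX; apply/eqP; exact: mdeg1.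
Qed.

Lemma arr_homog (P : pred 'rV[K]_3) s :
  \prod_(a <- s | P a) lf a \is (count P s).-homog.
Proof.
elim: s => [|a s IHs]; first by rewrite big_nil dhomog1.
rewrite big_cons /=; case: (P a) => //.
by apply: dhomogM => //; apply: lf_homog.
Qed.

Lemma cst_homog a : homog_of_degree 0 (cst a).
Proof.
by move=> i; rewrite cstE -[_%:MP]mulr1 mul_mpolyC; apply/dhomogZ/dhomog1.
Qed.

Lemma euler_homog : homog_of_degree 1 (euler K).
Proof. by move=> i; rewrite eulerE dhomogX; apply/eqP; exact: mdeg1. Qed.

Lemma grad_homog k F : F \is k.-homog -> homog_of_degree k.-1 (grad F).
Proof.
move=> /dhomogP Fh i; rewrite gradE; apply/dhomogP => m.
rewrite mcoeff_msupp mcoeff_mderiv => Fm.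
have : (m + U_(i))%MM \in msupp F.
  by rewrite mcoeff_msupp; apply: contraNneq Fm => ->; rewrite mul0rn.
move=> /Fh mE; have {mE} <- : mdeg (m + U_(i))%MM = k by exact: mE.
by rewrite mdegD mdeg1 addn1.
Qed.

Lemma dot_homog j k u v : homog_of_degree j u -> homog_of_degree k v ->
  dot u v \is (j + k).-homog.
Proof.
by move=> uh vh; rewrite dot.unlock; apply: rpred_sum => i _; apply: dhomogM.
Qed.

Lemma cross_homog j k u v : homog_of_degree j u -> homog_of_degree k v ->
  homog_of_degree (j + k) (cross u v).
Proof.
move=> uh vh; apply: ord3_ind; rewrite vecE;
  by apply: rpredB; apply: dhomogM.
Qed.

Lemma scale_homog j k F v : F \is j.-homog -> homog_of_degree k v ->
  homog_of_degree (j + k) (F *: v).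
Proof. by move=> Fh vh i; rewrite mxE; apply: dhomogM. Qed.

Lemma homogD k u v : homog_of_degree k u -> homog_of_degree k v ->
  homog_of_degree k (u + v).
Proof. by move=> uh vh i; rewrite mxE; apply: rpredD. Qed.

Lemma homogN k u : homog_of_degree k u -> homog_of_degree k (- u).
Proof. by move=> uh i; rewrite mxE; apply: rpredNr. Qed.

Lemma homog1_lf F : F \is 1.-homog -> exists a, F = lf a.
Proof.
move=> Fh; exists (\row_i F@_U_(i)); apply/mpolyP => m.
rewrite lfE dot.unlock raddf_sum /=.
under eq_bigr => i _ do rewrite eulerE cstE mulrC mcoeffCM mxE mcoeffX.
have [/mdeg1P [i /eqP ->]|m1] := boolP (mdeg m == 1%N).
  rewrite (bigD1 i) //= eqxx mulr1 big1 ?addr0 // => j ji.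
  case: eqP => [/mnmP/(_ j)|]; rewrite ?mulr0 //.
  by rewrite !mnm1E eqxx eq_sym (negbTE ji).
rewrite (dhomog_nemf_coeff Fh m1) big1 // => i _.
by case: eqP => [mE|]; rewrite ?mulr0 //; rewrite -mE mdeg1 in m1.
Qed.

Lemma D0E F v : D0 F v <-> dot v (grad F) = 0.
Proof.
by rewrite /D0 dot.unlock; under [X in _ <-> X = 0]eq_bigr do rewrite gradE.
Qed.

End Homog.

(** * The degree of the third generator *)

Section Bound.
Variable K : fieldType.
Local Notation S := {mpoly K[3]}.
Implicit Types (a b c l p q : 'rV[K]_3) (F G : S) (u v w th : 'rV[S]_3).
Implicit Types (s : seq 'rV[K]_3).
Local Notation part k F := (pihomog (@mdeg 3) k F).

Lemma arr_neq0 (P : pred 'rV[K]_3) s : {in s, forall a, a != 0} ->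
  \prod_(a <- s | P a) lf a != 0.
Proof.
move=> s0; rewrite prodf_seq_neq0; apply/allP => a /s0 /lf_neq0 ->.
by rewrite implybT.
Qed.

Definition away s q : S := \prod_(a <- s | dot a q != 0) lf a.

(** The constant field q kills the lines through q.  Multiplied by the lines that
miss q it maps the equation of the arrangement to a multiple of itself, and
the Euler term cancels this multiple. *)
Definition point_field s q : 'rV[S]_3 :=
  ((size s)%:R * away s q) *: cst q
  - dot (cst q) (grad (away s q)) *: euler K.

Lemma der_through s q :
  dot (cst q) (grad (\prod_(a <- s | dot a q == 0) lf a)) = 0.
Proof.
rewrite (@der_arr _ _ _ _ 0) ?mulr0 ?mul0r // => a _ /eqP aq.
by rewrite dot_cst dotC aq mpolyC0 mul0r.
Qed.

Lemma arr_through_away s q :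
  arr s = (\prod_(a <- s | dot a q == 0) lf a) * away s q.
Proof. by rewrite /arr (bigID (fun a => dot a q == 0)). Qed.

Lemma point_field_D0 s q : dot (point_field s q) (grad (arr s)) = 0.
Proof.
rewrite /point_field dotDl dotNl !dotZl euler_arr (arr_through_away s q) gradM.
rewrite dotDr !dotZr der_through; move: (\prod_(_ <- _ | _) _) (away s q).
by move=> x y; ring.
Qed.

Lemma point_field_homog s q : has (fun a => dot a q != 0) s ->
  homog_of_degree (count (fun a => dot a q != 0) s) (point_field s q).
Proof.
rewrite has_count; set k := count _ _ => k0.
have fh : away s q \is k.-homog by apply: arr_homog.
apply: homogD; last apply: homogN.
  rewrite -[k]addn0; apply: scale_homog (cst_homog _).
  by rewrite -mpolyC_nat mul_mpolyC; apply: dhomogZ.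
(* At least one line misses q, so that 1 can be subtracted from k. *)
have kE : (0 + k.-1 + 1 = k)%N by lia.
rewrite -[X in homog_of_degree X]kE; apply: scale_homog (@euler_homog K).
by apply: dot_homog (grad_homog fh); apply: cst_homog.
Qed.

Lemma count_through (T : eqType) (r : seq T) (P : pred T) (x y : T) :
  uniq r -> x \in r -> y \in r -> x != y -> ~~ P x -> ~~ P y ->
  (count P r + 2 <= size r)%N.
Proof.
move=> ur xr yr xy Px Py; rewrite -(count_predC P) leq_add2l -size_filter.
apply: (@uniq_leq_size _ [:: x; y]); first by rewrite /= inE xy.
by move=> z; rewrite !inE mem_filter => /orP[] /eqP -> /=; rewrite ?Px ?Py.
Qed.

(** The Euler corrections do not change the determinant, which is thus the product
of the two families of lines that miss a point and of the line h joining the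
points.  Every line through the first point other than h misses the second, so
the equation of the arrangement can be split off. *)
Lemma det3_point_fields s h b c : independent_forms s -> h \in s ->
  dot c (cross h b) != 0 ->
  det3 (euler K) (point_field s (cross h b)) (point_field s (cross h c)) =
  ((size s)%:R ^+ 2 * det3 h b c)%:MP * arr s *
  \prod_(a <- s | (dot a (cross h b) != 0) && (dot a (cross h c) != 0)) lf a.
Proof.
move=> [us s0 cs] hs cq; set q := cross h b; set r := cross h c.
rewrite det3_shear [det3 (euler K) _ _]/det3 cross_cst -lfE cross_pencil lfZ.
have Er : away s r * lf h =
   (\prod_(a <- s | dot a q == 0) lf a) *
   \prod_(a <- s | (dot a q != 0) && (dot a r != 0)) lf a.
  rewrite /away (bigID (fun a => dot a q == 0)) /=.
  rewrite mulrAC; congr (_ * _); last by apply: eq_bigl => a; rewrite andbC.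
  rewrite [RHS](bigID (fun a => dot a r == 0)) /= mulrC.
  congr (_ * _); last by apply: eq_bigl => a; rewrite andbC.
  transitivity (\prod_(a <- s | pred1 h a) lf a).
    by rewrite -big_filter (filter_pred1_uniq us hs) big_seq1.
  rewrite [LHS]big_seq_cond [RHS]big_seq_cond.
  apply: eq_bigl => a; case: (boolP (a \in s)) => //= als.
  apply/eqP/andP => [->|[/eqP aq /eqP ar]]; first by rewrite !dot_crossl eqxx.
  apply/eqP; apply: contraT => ah.
  have := cs a h als hs ah; case/negP; apply/eqP.
  have : cross a (cross q r) = 0.
    by rewrite cross_cross aq ar !scale0r subrr.
  rewrite cross_pencil crossZr => /eqP; rewrite scaler_eq0 => /orP[|/eqP //].
  by move: cq; rewrite /q -/(det3 c h b) det3_rot => /negbTE ->.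
rewrite mpolyCM [RHS]mulrAC (arr_through_away s q) rmorphXn /= mpolyC_nat.
move: Er; move: (away s r) (away s q) (lf h) => x y z.
move: (\prod_(_ <- _ | dot _ _ == 0) _) (\prod_(_ <- _ | _ && _) _) => t t' E.
transitivity ((size s)%:R ^+ 2 * (det3 h b c)%:MP * y * (x * z)); first by ring.
by rewrite E; ring.
Qed.

Variables (s : seq 'rV[K]_3) (g : 'I_3 -> 'rV[S]_3) (e : 'I_3 -> nat).
Hypotheses (ls : independent_forms s) (d0 : (size s)%:R != 0 :> K).
Hypotheses (gD : forall j, D0 (arr s) (g j))
  (gG : forall v, D0 (arr s) v -> exists c : 'I_3 -> S, v = \sum_j c j *: g j)
  (gh : forall j, homog_of_degree (e j) (g j)).
Hypotheses (e_gt0 : forall j, (0 < e j)%N) (e01 : (e i0 + e i1)%N = size s).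

(** If all lines passed through q, the constant field q would be an element of
degree 0, but all generators have positive degree. *)
Lemma not_pencil q : q != 0 -> has (fun a => dot a q != 0) s.
Proof.
apply: contraNT => /hasPn thr; apply/eqP/cst_eq0.
have : D0 (arr s) (cst q).
  apply/D0E; rewrite /arr (@der_arr _ _ _ _ 0) ?mulr0 ?mul0r // => a als _.
  have := thr a als; rewrite negbK dot_cst dotC => /eqP ->.
  by rewrite mpolyC0 mul0r.
move=> /gG [c /(homog_combination (cst_homog q) gh) ->].
by apply: big1 => j _; rewrite leqNgt e_gt0 scale0r.
Qed.

(** Suppose the contrary; then every element of degree at most d - 2 is a
combination of the first two generators, and the fields of two intersection
points lead to a line of the arrangement that avoids all intersection points. *)
Lemma third_degree_bound : (e i2 + 2 <= size s)%N.
Proof.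
have [us s0 cs] := ls; rewrite leqNgt; apply/negP => e2.
(* The third generator has too large a degree to occur. *)
have low k v : D0 (arr s) v -> homog_of_degree k v -> (k + 2 <= size s)%N ->
    exists x y, v = x *: g i0 + y *: g i1.
  move=> /gG [c vE] vh k2.
  pose c' j : S := if (e j <= k)%N then part (k - e j) (c j) else 0.
  have -> : v = \sum_j c' j *: g j := homog_combination vh gh vE.
  exists (c' i0), (c' i1).
  rewrite !big_ord_recr big_ord0 /= add0r.
  have -> : widen_ord (leqnSn 2) ord_max = i1 by apply: val_inj.
  have -> : widen_ord (leqnSn 2) (widen_ord (leqnSn 1) ord_max) = i0.
    exact: val_inj.
  have -> : ord_max = i2 by apply: val_inj.
  have -> : c' i2 = 0 by rewrite /c'; case: leqP => //; lia.
  by rewrite scale0r addr0.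
have logg j : logarithmic s (g j).
  by apply: der_logarithmic => //; move/D0E: (gD j) => ->; apply: ideal2_0.
have [alpha alphaE] := det3_logarithmic ls (@euler_logarithmic _ s) (logg i0) (logg i1).
have f0 : arr s != 0 by apply: arr_neq0.
(* alpha f has degree 1 + e0 + e1 = d + 1. *)
have [a' a'E] : exists a', alpha = lf a'.
  apply: homog1_lf.
  have alphah : alpha * arr s \is (size s).+1.-homog.
    rewrite -alphaE /det3.
    have -> : ((size s).+1 = 1 + (e i0 + e i1))%N by rewrite e01.
    by apply: dot_homog (@euler_homog K) _; apply: cross_homog.
  have := pihomogM_homog (size s).+1 alpha (arr_homog predT s).
  rewrite count_predT leqnSn subSnn (pihomog_dE alphah) => /(mulIf f0) ->.
  exact: pihomogP.
(* The intersection point of h and b is missed by a line k proportional to alpha.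
   The second point on h is cut out by a line c that misses the first. *)
have key h b : h \in s -> b \in s -> h != b ->
    a' != 0 /\ exists2 k, k \in s & dot k (cross h b) != 0 /\ cross a' k = 0.
  move=> hs bs hb; have q0 := cs h b hs bs hb.
  have /hasP [c cls cq] := not_pencil q0.
  have hc : h != c by apply: contra_neq cq => <-; rewrite dot_crossl.
  have r0 := cs h c hs cls hc.
  have field x : x \in s -> h != x -> cross h x != 0 ->
      exists y z, point_field s (cross h x) = y *: g i0 + z *: g i1.
    move=> xs hx qx0; apply: low (point_field_homog (not_pencil qx0)) _.
      by apply/D0E/point_field_D0.
    apply: (count_through us hs xs hx); rewrite negbK; apply/eqP.
      exact: dot_crossl.
    exact: dot_crossr.
  have [y [z qE]] := field b bs hb q0; have [y' [z' rE]] := field c cls hc r0.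
  have := det3_point_fields ls hs cq; rewrite qE rE det3_lin2 alphaE a'E.
  set P := (\prod_(_ <- _ | _) _); set t := (_ ^+ 2 * _) => E.
  have t0 : t != 0.
    by rewrite mulf_neq0 ?expf_neq0 // -det3_rot.
  have P0 : P != 0 by apply: arr_neq0.
  have PE : P = (t^-1)%:MP * (y * z' - z * y') * lf a'.
    have {}E : (y * z' - z * y') * lf a' = t%:MP * P.
      by apply: (mulIf f0); rewrite -mulrA E mulrAC.
    by rewrite -mulrA E mulrA -mpolyCM mulVf // mpolyC1 mul1r.
  have a0 : a' != 0.
    by apply: contra_neq P0 => a0; rewrite PE a0 lf0 mulr0.
  split=> //.
  suff /hasP [k ks /andP[kq /eqP ak]] :
      has (fun k => (dot k (cross h b) != 0) && (cross a' k == 0)) s.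
    by exists k.
  apply: contraT => /hasPn none; exfalso.
  apply: (@lf_arr_notin _ a' (fun a => (dot a (cross h b) != 0)
                                    && (dot a (cross h c) != 0)) s a0).
    move=> a als /andP[aq _]; have := none a als.
    by rewrite aq.
  by rewrite -/P PE; apply/ideal2Ml/ideal2_l.
have [h hs] : exists h, h \in s.
  case: (s) e01 => [|h t]; first by have := e_gt0 i0; rewrite /=; lia.
  by exists h; rewrite mem_head.
have /hasP [b bs bh] : has (predC1 h) s.
  apply: contraT; rewrite -all_predC => /allP /= sh.
  have : (size s <= size [:: h])%N.
    by apply: uniq_leq_size => // x /sh; rewrite negbK inE.
  by have := e_gt0 i0; have := e_gt0 i1; rewrite -e01 /=; lia.
rewrite /= eq_sym in bh.
have [a0 [k ks [_ ak]]] := key h b hs bs bh.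
(* Any line other than k meets k in a point that contradicts key: two lines of the
   arrangement proportional to alpha coincide. *)
have [h' h's h'k] : exists2 h', h' \in s & h' != k.
  by have [hk|] := eqVneq h k; [exists b => //; rewrite -hk eq_sym | exists h].
have [_ [k' k's [k'q ak']]] := key h' k h's ks h'k.
have kk' : k != k' by apply: contra_neq k'q => <-; rewrite dot_crossr.
by have := cs k k' ks k's kk'; rewrite (cross_eq0_trans a0 ak ak') eqxx.
Qed.

End Bound.

(** * Minimal systems of generators *)

Section Generators.
Variable K : fieldType.
Local Notation S := {mpoly K[3]}.
Implicit Types (M : 'rV[S]_3 -> Prop) (n : nat) (v : 'rV[S]_3).

(** Minimality of a generating family, as a condition on its relations: no
coefficient of a relation is 1. *)
Definition irredundant n (g : 'I_n -> 'rV[S]_3) :=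
  forall x : 'I_n -> S, \sum_j x j *: g j = 0 -> forall i, x i != 1.

Lemma generates_setT M n (g : 'I_n -> 'rV[S]_3) :
  generates M g [set: 'I_n] <->
  forall v, M v <-> exists c : 'I_n -> S, v = \sum_i c i *: g i.
Proof.
split=> gen v; split.
- by move=> /gen [c ->]; exists c; apply: eq_bigl => i; rewrite inE.
- by move=> [c ->]; apply/gen; exists c; apply: eq_bigl => i; rewrite inE.
- by move=> /gen [c ->]; exists c; apply: eq_bigl => i; rewrite inE.
- by move=> [c ->]; apply/gen; exists c; apply: eq_bigl => i; rewrite inE.
Qed.

Lemma minimal_generatorsP M n (g : 'I_n -> 'rV[S]_3) :
  minimal_generators M g <-> generates M g [set: 'I_n] /\ irredundant g.
Proof.
split=> [] [gen min]; split=> //; have genE := proj1 (generates_setT M g) gen.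
  move=> x xg i; apply/eqP => xi.
  have giE : g i = - \sum_(j | j != i) x j *: g j.
    by move: xg; rewrite (bigD1 i) //= xi scale1r => /eqP; rewrite addr_eq0 => /eqP.
  have : generates M g [set~ i].
    move=> v; split=> [/genE [c ->]|[c ->]].
      exists (fun j => c j - c i * x j).
      rewrite (bigD1 i) //= [X in c i *: X]giE scalerN scaler_sumr addrC -sumrB.
      by apply: eq_big => [j|j _]; rewrite ?inE // scalerBl scalerA.
    apply/genE; exists (fun j => if j == i then 0 else c j).
    rewrite [RHS](bigD1 i) //= eqxx scale0r add0r.
    by apply: eq_big => [j|j]; rewrite !inE // => /negbTE ->.
  by move=> /min /setP /(_ i); rewrite !inE eqxx.
move=> I genI; apply/setP => i; rewrite inE; apply: contraT => iI.
have : M (g i).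
  apply/genE; exists (fun j => (j == i)%:R).
  rewrite (bigD1 i) //= eqxx scale1r big1 ?addr0 // => j /negbTE ->.
  by rewrite scale0r.
move=> /genI [c giE].
have := min (fun j => if j == i then 1 else if j \in I then - c j else 0).
case/(_ _ i)/eqP; last by rewrite eqxx.
rewrite (bigD1 i) //= eqxx scale1r {1}giE; apply/eqP; rewrite addr_eq0 -sumrN.
rewrite big_mkcond [X in _ == X]big_mkcond /=; apply/eqP/eq_bigr => j _.
case: eqVneq => [->|_]; first by rewrite (negbTE iI).
by case: ifP; rewrite ?scaleNr ?opprK ?scale0r ?oppr0.
Qed.

Definition extend (T : Type) n (g : 'I_n -> T) (t : T) (i : 'I_n.+1) : T :=
  if unlift ord_max i is Some j then g j else t.

Lemma extend_lift (T : Type) n (g : 'I_n -> T) (t : T) j :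
  extend g t (lift ord_max j) = g j.
Proof. by rewrite /extend liftK. Qed.

Lemma extend_max (T : Type) n (g : 'I_n -> T) (t : T) :
  extend g t ord_max = t.
Proof. by rewrite /extend unlift_none. Qed.

Lemma sum_extend n (g : 'I_n -> 'rV[S]_3) t (x : 'I_n.+1 -> S) :
  \sum_i x i *: extend g t i =
  \sum_j x (lift ord_max j) *: g j + x ord_max *: t.
Proof.
rewrite (bigD1_ord ord_max) //= extend_max addrC; congr (_ + _).
by apply: eq_bigr => j _; rewrite extend_lift.
Qed.

Lemma homog_extend n (g : 'I_n -> 'rV[S]_3) t e k :
  (forall j, homog_of_degree (e j) (g j)) -> homog_of_degree k t ->
  forall i, homog_of_degree (extend e k i) (extend g t i).
Proof. by move=> gh th i; rewrite /extend; case: unlift. Qed.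

End Generators.

(** * Adding a transverse line *)

Section Addition.
Variables (K : fieldType) (s : seq 'rV[K]_3) (l : 'rV[K]_3).
Local Notation S := {mpoly K[3]}.
Local Notation d := (size s).
Hypotheses (ls : independent_forms s) (tls : transverse l s).
Hypotheses (d_neq0 : d%:R != 0 :> K) (d1_neq0 : d.+1%:R != 0 :> K).
Implicit Types (th eta : 'rV[S]_3) (q : S).

Local Notation f := (arr s).
Local Notation T := (tangent_field l (arr s)).

(** The Euler term is chosen so that the sum kills l f: the first term maps l f to
eta(l) l f, and E multiplies l f by its degree d + 1. *)
Definition lift_der eta : 'rV[S]_3 :=
  lf l *: eta - ((d.+1%:R^-1)%:MP * dot eta (cst l)) *: euler K.

Lemma lift_der_sum n (g : 'I_n -> 'rV[S]_3) (c : 'I_n -> S) :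
  lift_der (\sum_j c j *: g j) = \sum_j c j *: lift_der (g j).
Proof.
rewrite /lift_der dot_suml scaler_sumr mulr_sumr scaler_suml -sumrB.
apply: eq_bigr => j _; rewrite dotZl scalerBr !scalerA.
by congr (_ *: _ - _ *: _); ring.
Qed.

Lemma invMP (k : nat) : k%:R != 0 :> K -> (k%:R^-1)%:MP * k%:R = 1 :> S.
Proof. by move=> k0; rewrite -mpolyC_nat -mpolyCM mulVf // mpolyC1. Qed.

Lemma lf_l_neq0 : lf l != 0.
Proof. by case: tls => l0 _ _; apply: lf_neq0. Qed.

Lemma arr_notin_l : ~ ideal2 (lf l) 0 f.
Proof. by case: tls => l0 lc _; apply: lf_arr_notin => // a als _; apply: lc. Qed.

Lemma prime_l : prime_ideal2 (lf l) 0.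
Proof. by case: tls => l0 _ _; apply: lf_prime1. Qed.

Lemma lift_der_D0 eta : D0 f eta -> D0 (lf l * f) (lift_der eta).
Proof.
move=> /D0E eta0; apply/D0E; rewrite /lift_der gradM grad_lf.
rewrite dotDl dotNl !dotZl !dotDr !dotZr eta0 euler_arr -lfE.
move: (lf l) f (dot eta _) => x y z; have := invMP d1_neq0.
move: (_%:MP) => r; rewrite -natr1 => rd.
transitivity (x * y * z * (1 - r * (d%:R + 1))); first by ring.
by rewrite rd subrr mulr0.
Qed.

Lemma tangent_field_addition : D0 (lf l * f) T.
Proof.
apply/D0E; rewrite gradM grad_lf dotDr !dotZr.
by rewrite tangent_field_l tangent_field_D0 !mulr0 addr0.
Qed.

(** The coefficient of E to add to theta is determined by theta(l) = h l: since
theta(f) = - h f, the field theta + (h/d) E kills f. *)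
Lemma addition_decomposition th : D0 (lf l * f) th ->
  exists q eta, D0 f eta /\ th = q *: T + lift_der eta.
Proof.
move=> /D0E; rewrite gradM grad_lf dotDr !dotZr => th0.
have [h hE] : exists h, dot th (cst l) = h * lf l.
  apply: ideal2_x0; case: (@prime_l f (dot th (cst l))) => [|/arr_notin_l|//] //.
  exists (- dot th (grad f)), 0; move: th0 => /(canRL (addKr _)) ->.
  by ring.
have thf : dot th (grad f) = - h * f.
  apply: (mulfI lf_l_neq0); move: th0; rewrite hE => /eqP.
  by rewrite addr_eq0 => /eqP ->; ring.
have rd := invMP d_neq0; set r := _%:MP in rd.
pose th' := th + (r * h) *: euler K.
have th'0 : dot th' (grad f) = 0.
  rewrite dotDl dotZl thf euler_arr; move: f => y.
  transitivity (h * y * (r * d%:R - 1)); first by ring.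
  by rewrite rd subrr mulr0.
have th'l : dot th' (cst l) = (h + r * h) * lf l.
  by rewrite dotDl dotZl hE -lfE; ring.
have [q [eta th'E]] : exists q eta, th' = q *: T + lf l *: eta.
  apply: tangent_decomposition => //.
  by exists (h + r * h), 0; rewrite th'l; ring.
exists q, eta; split.
  apply/D0E/(mulfI lf_l_neq0); rewrite -dotZl mulr0 -th'0 th'E dotDl.
  by rewrite !dotZl tangent_field_D0 mulr0 add0r.
have etal : dot eta (cst l) = h + r * h.
  apply: (mulfI lf_l_neq0); rewrite [RHS]mulrC -th'l th'E dotDl !dotZl.
  by rewrite tangent_field_l mulr0 add0r.
have r1E : (d.+1%:R^-1)%:MP * (h + r * h) = r * h.
  have := invMP d1_neq0; move: (_%:MP) => r1; rewrite -natr1 => r1d.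
  transitivity (r1 * (d%:R + 1) * (r * h) + r1 * h * (1 - r * d%:R)).
    by ring.
  by rewrite r1d rd subrr mulr0 addr0 mul1r.
by rewrite /lift_der etal r1E addrA -th'E addrK.
Qed.

(** Evaluating the relation at l shows that eta kills l, so the Euler term of the
lift vanishes and q T is divisible by l.  But E x T is congruent modulo l to
d f times the coefficient vector of l, and l does not divide f, so l divides q. *)
Lemma addition_relation q eta : D0 f eta -> q *: T + lift_der eta = 0 ->
  exists c, q = c * lf l /\ eta + c *: T = 0.
Proof.
move=> eta0 rel.
have etal : dot eta (cst l) = 0.
  have := congr1 (fun v => dot v (cst l)) rel.
  rewrite /lift_der !(dotDl, dotNl, dotZl) tangent_field_l dot0l -lfE.
  have := invMP d_neq0; move: (_%:MP) => r rd.
  have := invMP d1_neq0; move: (_%:MP) => r1; rewrite -natr1 => r1d E.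
  apply: (mulfI lf_l_neq0); rewrite mulr0.
  move: E; move: (lf l) (dot eta _) => x y E.
  (* r and r1 are the inverses of d and d + 1; the relation says (1 - r1) x y = 0,
     and 1 - r1 = d / (d + 1). *)
  transitivity (r * (d%:R + 1) * (q * 0 + (x * y - r1 * y * x))
    + x * y * (1 - r * d%:R) + r * x * y * (r1 * (d%:R + 1) - 1)); first by ring.
  by rewrite E rd r1d !subrr !mulr0 !addr0.
have {}rel : q *: T + lf l *: eta = 0.
  by move: rel; rewrite /lift_der etal mulr0 scale0r subr0.
have [l0 _ _] := tls; have [p pl] := neq0_dot l0.
have ql : ideal2 (lf l) 0 q.
  have : ideal2 (lf l) 0 (q * (d%:R * f)).
    have := congr1 (fun v => dot (cst p) (cross (euler K) v)) rel.
    rewrite cross0r dot0r crossDr !crossZr dotDr !dotZr cross_cross.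
    rewrite dotDr dotNr !dotZr dot_cst pl mpolyC1 mulr1 euler_arr -lfE => E.
    exists (q * dot (cst p) (grad f) - dot (cst p) (cross (euler K) eta)), 0.
    by move/eqP: E; rewrite mulrBr -addrA addr_eq0 => /eqP ->; ring.
  case/prime_l => // df; case: arr_notin_l.
  have rd := invMP d_neq0; move: (_%:MP) rd => r rd.
  have -> : f = r * (d%:R * f) by rewrite mulrA rd mul1r.
  exact: ideal2Ml.
have [c qE] := ideal2_x0 ql; exists c; split=> //.
apply/rowP => i; apply: (mulfI lf_l_neq0); move: rel => /rowP/(_ i).
by rewrite qE !mxE mulr0 => <-; ring.
Qed.

Lemma tangent_field_homog : homog_of_degree d.-1 T.
Proof.
rewrite -[d.-1]add0n; apply: cross_homog; first exact: cst_homog.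
by apply: grad_homog; rewrite -[X in X.-homog](count_predT s); apply: arr_homog.
Qed.

Lemma lift_der_homog k eta : homog_of_degree k eta ->
  homog_of_degree k.+1 (lift_der eta).
Proof.
move=> etah; apply: homogD.
  by rewrite -add1n; apply: scale_homog (lf_homog l) etah.
apply: homogN; rewrite -addn1; apply: scale_homog (@euler_homog K).
rewrite mul_mpolyC; apply: dhomogZ; rewrite -[k]addn0.
by apply: dot_homog => //; apply: cst_homog.
Qed.

(** The bound on the degrees serves only irredundancy: in degree e j, below the
degree d - 1 of T, a relation that involves T reduces to one between the old
generators. *)
Lemma addition_generators n (g : 'I_n -> 'rV[S]_3) (e : 'I_n -> nat) :
  minimal_generators (D0 f) g -> (forall j, homog_of_degree (e j) (g j)) ->
  (forall j, (e j < d.-1)%N) ->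
  minimal_generators (D0 (lf l * f)) (extend (fun j => lift_der (g j)) T).
Proof.
move=> /minimal_generatorsP [/generates_setT genE irr] gh elt.
apply/minimal_generatorsP; split.
  apply/generates_setT => th; split.
    move=> /addition_decomposition [q [eta [/genE [c ->] ->]]].
    exists (extend c q); rewrite sum_extend extend_max lift_der_sum addrC.
    by congr (_ + _); apply: eq_bigr => j _; rewrite extend_lift.
  move=> [c ->]; rewrite sum_extend -lift_der_sum; apply/D0E.
  rewrite dotDl dotZl (proj1 (D0E _ _) tangent_field_addition) mulr0 addr0.
  by apply/D0E/lift_der_D0/genE; exists (fun j => c (lift ord_max j)).
move=> x; rewrite sum_extend -lift_der_sum addrC => rel.
have [] := addition_relation _ rel.
  by apply/genE; exists (fun j => x (lift ord_max j)).
move=> c [xmax rel'] i; have [j ->|->] := unliftP ord_max i; last first.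
  rewrite xmax; apply/eqP => cl; apply: (@one_notin1 K l).
  by exists c, 0; rewrite cl mul0r addr0.
apply/eqP => xj.
pose y := extend (fun j => x (lift ord_max j)) c.
have rel0 : 0 = \sum_i y i *: extend g T i.
  apply/esym; rewrite sum_extend /y extend_max -[RHS]rel'; congr (_ + _).
  by apply: eq_bigr => i' _; rewrite extend_lift.
have h0 : homog_of_degree (e j) (0 : 'rV[S]_3).
  by move=> i'; rewrite mxE; apply: dhomog0.
have := homog_combination h0 (homog_extend gh tangent_field_homog) rel0.
rewrite sum_extend extend_max leqNgt elt scale0r addr0 => /esym/irr/(_ j)/eqP[].
rewrite !extend_lift leqnn subnn /y extend_lift xj.
by apply: pihomog_dE; apply: dhomog1.
Qed.

End Addition.

(** * Lines and points of the projective plane *)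

Lemma uniq_map_inj (T T' : eqType) (f : T -> T') (r : seq T) :
  uniq (map f r) -> {in r &, injective f}.
Proof.
move=> ur x y xr yr fxy; rewrite -(nth_index x xr) -(nth_index x yr).
congr (nth _ _ _); apply/eqP.
rewrite -(nth_uniq (f x) _ _ ur) ?size_map ?index_mem //.
by rewrite !(nth_map x) ?index_mem // !nth_index // fxy.
Qed.

Local Open Scope fset_scope.

Section Geometry.
Variable K : numFieldType.
Implicit Types (H L : line K) (p : point K) (A : arrangement K).

Lemma vline_scale (V : vectType K) (t : K) (v : V) : t *: v != 0 ->
  <[t *: v]>%VS = <[v]>%VS.
Proof.
rewrite scaler_eq0 negb_or => /andP[t0 v0]; apply: subv_anti.
rewrite -!memvE memvZ ?memv_line //=.
by rewrite -[X in X \in _](scalerK t0) memvZ ?memv_line.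
Qed.

Lemma vpick_line (V : vectType K) (U : {vspace V}) : \dim U == 1%N ->
  vpick U != 0 /\ <[vpick U]>%VS = U.
Proof.
move=> /eqP dimU; have U0 : vpick U != 0 by rewrite vpick0 -dimv_eq0 dimU.
split=> //; apply/eqP; rewrite eqEdim dim_vline U0 dimU leqnn andbT.
by rewrite -memvE memv_pick.
Qed.

Definition vec H : 'rV[K]_3 := (vpick (val H))^T.

Lemma vec_neq0 H : vec H != 0.
Proof. by rewrite trmx_eq0; case: (vpick_line (valP H)). Qed.

Lemma line_formE H : line_form H = lf (vec H).
Proof.
rewrite lfE dot.unlock; apply: eq_bigr => i _.
by rewrite eulerE cstE mxE mulrC mul_mpolyC.
Qed.

Lemma cross_vec H H' : H != H' -> cross (vec H) (vec H') != 0.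
Proof.
apply: contra_neq => /(parallel (vec_neq0 H)) [t tE]; apply: val_inj.
have [_ <-] := vpick_line (valP H); have [n0 HE] := vpick_line (valP H').
have tE' : vpick (val H') = t *: vpick (val H).
  by apply: trmx_inj; rewrite linearZ.
by rewrite -[RHS]HE tE' vline_scale // -tE'.
Qed.

Lemma on_lineE p H : on_line p H = (dot (vpick (val p)) (vec H) == 0).
Proof. by rewrite /on_line line_formE -/(at_pt _ _) at_lf dotC. Qed.

Definition vecs A : seq 'rV[K]_3 := [seq vec H | H <- A].

Lemma arr_eqnE A : arr_eqn A = arr (vecs A).
Proof.
by rewrite /arr_eqn /arr big_map; apply: eq_bigr => H _; apply: line_formE.
Qed.

Lemma arr_eqnU1 A L : L \notin A ->
  arr_eqn (A `|` [fset L]) = lf (vec L) * arr (vecs A).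
Proof.
move=> LA; rewrite -line_formE -arr_eqnE fsetUC /arr_eqn.
by rewrite (big_fsetU1 _ _ LA).
Qed.

Lemma vec_inj : injective vec.
Proof.
move=> H H' e; apply/eqP; apply: contraT => /cross_vec.
by rewrite e crossxx eqxx.
Qed.

Lemma independent_vecs A : independent_forms (vecs A).
Proof.
split; first by rewrite map_inj_uniq ?fset_uniq //; apply: vec_inj.
  by move=> _ /mapP[H _ ->]; apply: vec_neq0.
move=> _ _ /mapP[H _ ->] /mapP[H' _ ->] HH'.
by apply: cross_vec; apply: contra_neq HH' => ->.
Qed.

Lemma size_vecs A : size (vecs A) = #|` A|.
Proof. by rewrite size_map cardfE. Qed.

Lemma point_of (v : 'rV[K]_3) : v != 0 ->
  exists2 p, val p = <[v]>%VS & forall H, dot v (vec H) = 0 -> on_line p H.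
Proof.
move=> v0; have dv : \dim <[v]>%VS == 1%N by rewrite dim_vline v0.
pose isP (V : {vspace 'rV[K]_3}) := is_true (\dim V == 1%N).
exists (exist isP _ dv) => // H vH; rewrite on_lineE /=.
have /vlineP [t ->] := memv_pick <[v]>%VS.
by rewrite dotZl vH mulr0.
Qed.

Variables (A : arrangement K) (L : line K) (ps : {fset point K}).
Hypotheses (card_ps : #|` ps| = #|` A|) (card_A : (1 < #|` A|)%N)
  (psP : forall p, p \in ps <-> on_line p L /\ on_arrangement p A).

(** A line of the arrangement has infinitely many points on the arrangement, while
ps is finite. *)
Lemma line_notin : L \notin A.
Proof.
apply/negP => LA.
have [H HA HL] : exists2 H, H \in A & L != H.
  have : A `\ L != fset0.
    by rewrite -cardfs_gt0; have := cardfsD1 L A; rewrite LA; lia.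
  by move=> /fset0Pn [H]; rewrite !inE eq_sym => /andP[HL HA]; exists H.
set a := vec L; have LH := cross_vec HL; have a0 : a != 0 := vec_neq0 L.
have [e ec] := neq0_dot LH.
(* u is the point where L meets another line H, and v a second point of L. *)
pose u := cross a (vec H); pose v := cross a e.
have uv : cross u v != 0.
  rewrite cross_pencil scaler_eq0 negb_or a0 andbT.
  have -> : det3 a (vec H) e = 1 by rewrite -ec /det3 !vecE; ring.
  by rewrite oner_eq0.
pose w k : 'rV[K]_3 := (u + k%:R *: v)%R.
have crossw j k : cross (w j) (w k) = (k%:R - j%:R) *: cross u v.
  exact: cross_secant.
have w0 k : w k != 0.
  apply: contra_neq uv => wk; have := crossw k k.+1.
  rewrite wk (_ : cross 0 _ = 0) -?natr1; last by rewrite crossC cross0r oppr0.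
  by rewrite addrAC subrr add0r scale1r => <-.
have : (size [seq <[w k]>%VS | k <- iota 0 #|` A|.+1]
        <= size [seq val p | p <- ps])%N.
  apply: uniq_leq_size.
    rewrite map_inj_uniq ?iota_uniq // => j k wjk.
    apply/eqP; apply: contraT => jk.
    have : w j \in <[w k]>%VS by rewrite -wjk memv_line.
    move=> /vlineP [t wj]; have := crossw j k; rewrite wj.
    rewrite crossC crossZr crossxx scaler0 oppr0 => /esym/eqP.
    by rewrite scaler_eq0 (negbTE uv) orbF subr_eq0 eqr_nat eq_sym (negbTE jk).
  move=> _ /mapP [k _ ->]; have [p pE pon] := point_of (w0 k).
  apply/mapP; exists p => //; apply/psP.
  have pL : on_line p L.
    by apply: pon; rewrite -/a /w /u /v !vecE !(vecE, mxE); ring.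
  by split=> //; exists L.
by rewrite !size_map size_iota -card_ps cardfE ltnn.
Qed.

(** The map that sends H to the point where it meets L hits every point of ps, and
ps has as many points as the arrangement has lines, so the map is injective. *)
Lemma transverse_vecs : transverse (vec L) (vecs A).
Proof.
have LH H : H \in A -> cross (vec L) (vec H) != 0.
  by move=> HA; apply: cross_vec; apply: contraNneq line_notin => ->.
split; first exact: vec_neq0.
  by move=> _ /mapP[H HA ->]; apply: LH.
pose pt H := <[cross (vec L) (vec H)]>%VS.
have uniq_pt : uniq [seq pt H | H <- A].
  apply: (@leq_size_uniq _ [seq val p | p <- ps]).
  - by rewrite map_inj_uniq ?fset_uniq //; apply: val_inj.
  - move=> _ /mapP[p /psP [pL [H HA pH]] ->]; apply/mapP; exists H => //.
    move: pL pH; rewrite !on_lineE => /eqP pL /eqP pH.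
    have : cross (cross (vec L) (vec H)) (vpick (val p)) = 0.
      by rewrite crossC cross_cross pL pH !scale0r subrr oppr0.
    move=> /(parallel (LH H HA)) [t tE].
    have [p0 <-] := vpick_line (valP p).
    by rewrite tE vline_scale // -tE.
  - by rewrite !size_map; apply: eq_leq; exact: (esym card_ps).
move=> _ _ /mapP[H HA ->] /mapP[H' HA' ->] HH'.
have {}HH' : H != H' by apply: contra_neq HH' => ->.
apply: contra_neq HH' => det0.
have /(parallel (LH H HA)) [t tE] :
    cross (cross (vec L) (vec H)) (cross (vec L) (vec H')) = 0.
  by rewrite cross_pencil det0 scale0r.
have ptE : pt H = pt H' by rewrite /pt tE vline_scale // -tE LH.
exact: (uniq_map_inj uniq_pt).
Qed.

End Geometry.

Theorem theorem1p15 (R : realType) (A' : arrangement R[i]) (m1 m2 m3 : nat)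
    (L : line R[i]) :
  has_type_exponents A' 1 [:: m1; m2; m3] ->
  (3 <= m1)%N ->
  (exists ps : {fset point R[i]},
     #|` ps| = #|` A'| /\
     forall p : point R[i], p \in ps <-> on_line p L /\ on_arrangement p A') ->
  type_2B (A' `|` [fset L]) /\
  exponents (arr_eqn (A' `|` [fset L]))
    [:: m1.+1; m2.+1; m3.+1; (m1 + m2 - 1)%N].
Proof.
move=> [[sorted_m [g [ming gh]]] type1] m1_ge3 [ps [card_ps psP]].
have cardA : #|` A'| = (m1 + m2)%N by move: type1 => /=; lia.
move: sorted_m => /= /and3P[m12 m23 _].
have cardA1 : (1 < #|` A'|)%N by rewrite cardA; lia.
have LA : L \notin A' := line_notin card_ps cardA1 psP.
have tL : transverse (vec L) (vecs A') := transverse_vecs card_ps cardA1 psP.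
have ls := independent_vecs A'.
have dE : size (vecs A') = (m1 + m2)%N by rewrite size_vecs.
have d_neq0 : (size (vecs A'))%:R != 0 :> R[i] by rewrite pnatr_eq0 dE; lia.
have d1_neq0 : (size (vecs A')).+1%:R != 0 :> R[i] by rewrite pnatr_eq0.
rewrite arr_eqnE in ming.
pose e (j : 'I_3) := nth 0%N [:: m1; m2; m3] j.
have m3_le : (m3 + 2 <= m1 + m2)%N.
  have [/generates_setT genE _] := proj1 (minimal_generatorsP _ _) ming.
  rewrite -dE; apply: (@third_degree_bound _ _ g e ls d_neq0 _ _ gh _ (esym dE)).
  - move=> j; apply/genE; exists (fun k => (k == j)%:R).
    rewrite (bigD1 j) //= eqxx scale1r big1 ?addr0 // => k /negbTE ->.
    by rewrite scale0r.
  - by move=> v /genE.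
  - by case=> [[|[|[|j]]] ltj] //; rewrite /e /=; lia.
have elt j : (e j < (size (vecs A')).-1)%N.
  by rewrite dE; case: j => [[|[|[|j]]] ltj] //; rewrite /e /=; lia.
have := addition_generators ls tL d_neq0 d1_neq0 ming gh elt.
set G := extend _ _ => minG.
have eqnE := arr_eqnU1 LA.
have expo : exponents (arr_eqn (A' `|` [fset L]))
    [:: m1.+1; m2.+1; m3.+1; (m1 + m2 - 1)%N].
  split; first by rewrite /=; lia.
  exists G; split; first by rewrite eqnE.
  have Gh := homog_extend (fun j => lift_der_homog (vecs A') (vec L) (gh j))
    (tangent_field_homog (vecs A') (vec L)).
  move=> i; have := Gh i; congr homog_of_degree.
  have [j ->|->] := unliftP ord_max i; rewrite ?extend_lift ?extend_max /=.
    by rewrite /bump /=; case: j => [[|[|[|j]]] ltj].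
  by rewrite dE subn1.
split=> //; exists [:: m1.+1; m2.+1; m3.+1; (m1 + m2 - 1)%N] => //.
split=> //=; rewrite fsetUC cardfsU1 LA cardA /=; lia.
Qed.
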